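(* (a) Let $n>1$ be an integer. If there is an $n$-satisfactory coloring of $\mathbb Z^+$, then the set of all $n$-satisfactory colorings of $\mathbb Z^+$ has cardinality $\mathfrak c=|\mathbb R|$. (b) Let $n$ be a positive integer. Any $n$-satisfactory coloring $c$ of $\mathbb Z^+$ is determined by a family $(c_a)_{a\in P_n}$ of $n$-satisfactory colorings of $K_n$ and a family $(\pi_a)_{a\in P_n}$ of permutations of $[n]$ with $\pi_1$ the identity, in the sense that $c(ak)=\pi_a(c_a(k))$ for all $a\in P_n$ and $k\in K_n$. (c) On the other hand, there are values of $n$ for which there are only finitely many $n$-satisfactory colorings of $K_n$, and there are other values of $n$ for which the set of $n$-satisfactory colorings of $K_n$ has cardinality $\mathfrak c$.
   Context: $[n]=\{1,\dots,n\}$. $K_n$ (the $n$-core) is the set of positive integers all of whose prime factors are less than or equal to $n$. $P_n$ is the set of positive integers all of whose prime factors are strictly larger than $n$; in particular $1\in P_n$. For $X=\mathbb Z^+$ or $X=K_n$, an $n$-satisfactory coloring of $X$ is a coloring of $X$ using exactly $n$ colors such that for every $a\in X$ the elements $a,2a,\dots,na$ all receive different colors. For counting purposes, and since the names of the colors are irrelevant, an $n$-satisfactory coloring of $X$ is taken to be a map $c:X\to[n]$ with $c(i)=i$ for all $i\in[n]$ (equivalently, colorings are identified when they have the same color classes). *)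

(* Defs.v *)
From mathcomp Require Import all_boot all_order all_fingroup.
From mathcomp Require Import all_classical.

Set Implicit Arguments.
Unset Strict Implicit.
Unset Printing Implicit Defensive.

Local Open Scope classical_set_scope.
Local Open Scope nat_scope.

Definition posnat : set nat := [set m | 0 < m].

Definition smooth (n : nat) : set nat :=
  [set m | 0 < m /\ forall p, prime p -> p %| m -> p <= n].

Definition rough (n : nat) : set nat :=
  [set m | 0 < m /\ forall p, prime p -> p %| m -> n < p].

(* The set [n] = {1, ..., n} of factors and of colors is encoded by 'I_n,
   i : 'I_n standing for the integer i.+1.
   The coloring c is defined on the elements of X only, so that colorings
   can be counted. The products i * a are taken through elements x of X with
   val x = i * a; they exist when X is posnat or smooth n, see posnat_mul and
   smooth_mul below. *)
Definition satisfactory (n : nat) (X : set nat) : set (X -> 'I_n) :=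
  [set c | (forall (a x y : X) (i j : 'I_n),
              val x = i.+1 * val a -> val y = j.+1 * val a ->
              i != j -> c x != c y)
           /\ (forall (x : X) (i : 'I_n), val x = i.+1 -> c x = i)].

Definition glues (n : nat) (c : posnat -> 'I_n)
    (cs : rough n -> smooth n -> 'I_n) (pi : rough n -> {perm 'I_n}) : Prop :=
  forall (a : rough n) (k : smooth n) (x : posnat),
    val x = val a * val k -> c x = pi a (cs a k).

Lemma posnat_mul (n : nat) (i : 'I_n) (a : nat) :
  posnat a -> posnat (i.+1 * a).
Proof. by rewrite /posnat /= muln_gt0. Qed.

Lemma smooth_mul (n : nat) (i : 'I_n) (a : nat) :
  smooth n a -> smooth n (i.+1 * a).
Proof.
case=> a_gt0 Ha; split=> [|p p_pr]; first by rewrite muln_gt0.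
rewrite Euclid_dvdM// => /orP[pi|]; last exact: Ha.
by rewrite (leq_trans (dvdn_leq _ pi)).
Qed.

(* Main.v *)
Require Import Defs.
From mathcomp Require Import all_boot all_order all_fingroup.
From mathcomp Require Import all_algebra lra.
From mathcomp Require Import all_classical all_reals.

(** Both cardinalities equal to that of the continuum come from one construction.
Take a coloring [c], a fixed-point free injection [sigma] of the colors, and a
level function on [X].  Choose freely a set of levels and replace [c x] by
[sigma (c x)] at the points whose level was chosen.  The result is again
satisfactory as soon as, for any two multiples [i * a] and [j * a], either they
lie on the same level, so that [sigma] is applied to both or to neither, or
their colors cannot be made equal by applying [sigma] to one of them.  Keeping
the levels 0 and 1 untwisted preserves the prescribed colors of 1, ..., n, and
each other level contributes a free binary choice; [twist_continuum] concludes.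

For the positive integers, the level of [x] is the exponent in [x] of a prime
[q > n].  Multiplying by a number at most [n] does not change it, so any two
competing multiples share their level and [sigma] can be the cyclic shift.

For the core, when [n + 1] is prime, reading [x] modulo [n + 1] gives a
satisfactory coloring, because the elements of the core are invertible modulo
[n + 1].  With [n = 6], take for [sigma] the multiplication by 2 modulo 7, and
for level of [x] the sum of the exponents of 3 and 5 in [x].  Among 1, ..., 6
the numbers 1, 2, 4 of level 0 are exactly the quadratic residues modulo 7, and
3, 5, 6 have level 1.  So two multiples of [a] on different levels have colors
whose ratio is not a square modulo 7, whereas 2 is a square; hence [sigma] never
makes them collide.  With [n = 2] the core consists of the powers of 2, and
consecutive powers must alternate, so the coloring is unique.

The decomposition of a coloring [c] of the positive integers rests on the
unique writing of an integer as [a * k] with [a] rough and [k] smooth: the colors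
of [a, 2a, ..., na] define the permutation [pi_a], and [c_a] is the coloring
[k |-> c (a * k)] renormalized by the inverse of [pi_a].

The comparison with the real line is an application of the Cantor-Bernstein
theorem: binary sequences embed in the reals by ternary expansions, and reals
embed in binary sequences by Dedekind cuts. *)

Set Implicit Arguments.
Unset Strict Implicit.
Unset Printing Implicit Defensive.

Local Open Scope classical_set_scope.
Local Open Scope card_scope.
Local Open Scope nat_scope.

(** * The cardinality of the real line *)

Section TernaryReal.
Variable R : realType.
Import Order.TTheory GRing.Theory Num.Theory.
Local Open Scope ring_scope.

Definition ternary_sum (f : nat -> bool) (m : nat) : R :=
  \sum_(i < m) (f i)%:R * 3%:R^-1 ^+ i.

(** The last term is the sum of the geometric tail from index [m], so the intervals
from [ternary_sum f m] to [ternary_upper f m] are nested and shrink to the real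
number that [f] encodes. *)
Definition ternary_upper (f : nat -> bool) (m : nat) : R :=
  ternary_sum f m + 3%:R / 2%:R * 3%:R^-1 ^+ m.

Definition ternary_real (f : nat -> bool) : R := sup (range (ternary_sum f)).

Lemma ternary_sumS f m :
  ternary_sum f m.+1 = ternary_sum f m + (f m)%:R * 3%:R^-1 ^+ m.
Proof. by rewrite /ternary_sum big_ord_recr. Qed.

Lemma ternary_pow_gt0 m : 0 < 3%:R^-1 ^+ m :> R.
Proof. by rewrite exprn_gt0// invr_gt0 ltr0n. Qed.

Lemma ternary_sum_le_upper f m m' : ternary_sum f m' <= ternary_upper f m.
Proof.
have sum_nondecr d k : ternary_sum f k <= ternary_sum f (d + k)%N.
  elim: d => [//|d /le_trans]; apply; rewrite addSn ternary_sumS lerDl.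
  by rewrite mulr_ge0 ?ler0n// ltW// ternary_pow_gt0.
have upper_noninc d k : ternary_upper f (d + k)%N <= ternary_upper f k.
  elim: d => [//|d IH]; apply: le_trans IH.
  rewrite addSn /ternary_upper ternary_sumS exprS.
  by have := ternary_pow_gt0 (d + k); case: (f _) => /=; nra.
have sum_le k : ternary_sum f k <= ternary_upper f k.
  by rewrite /ternary_upper; have := ternary_pow_gt0 k; lra.
have [/subnK <-|/ltnW/subnK <-] := leqP m m'.
  exact: le_trans (sum_le _) (upper_noninc _ _).
exact: le_trans (sum_nondecr _ _) (sum_le _).
Qed.

Lemma ternary_real_ge f m : ternary_sum f m <= ternary_real f.
Proof.
apply: ub_le_sup; last by exists m.
by exists (ternary_upper f 0) => _ [k _ <-]; exact: ternary_sum_le_upper.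
Qed.

Lemma ternary_real_le f m : ternary_real f <= ternary_upper f m.
Proof.
apply: ge_sup; first by exists (ternary_sum f 0), 0%N.
by move=> _ [k _ <-]; exact: ternary_sum_le_upper.
Qed.

(** The tail after index [k] of the smaller expansion is worth at most half of the
digit gained at [k] by the larger one. *)
Lemma ternary_real_lt f g k :
    (forall i, (i < k)%N -> f i = g i) -> f k = false -> g k = true ->
  ternary_real f < ternary_real g.
Proof.
move=> fg fk gk.
have eq_sum : ternary_sum f k = ternary_sum g k.
  by apply: eq_bigr => i _; rewrite fg.
have := ternary_real_ge g k.+1; have := ternary_real_le f k.+1.
rewrite /ternary_upper !ternary_sumS fk gk eq_sum exprS /=.
by have := ternary_pow_gt0 k; nra.
Qed.

Lemma ternary_real_inj : injective ternary_real.
Proof.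
move=> f g eq_fg; apply: contrapT => /eqP neq_fg.
have ex_diff : exists k, f k != g k.
  apply: contrapT => nex; move/eqP: neq_fg; apply; apply/funext => k.
  by apply: contrapT => /eqP fgk; apply: nex; exists k.
have [k fgk k_min] := ex_minnP ex_diff.
have fg i : (i < k)%N -> f i = g i.
  by move=> ik; apply/eqP; apply: contraTT ik => /k_min; rewrite leqNgt.
have gf i : (i < k)%N -> g i = f i by move=> /fg.
case fk: (f k) fgk; case gk: (g k) => // _.
  by have := ternary_real_lt gf gk fk; rewrite eq_fg ltxx.
by have := ternary_real_lt fg fk gk; rewrite eq_fg ltxx.
Qed.

(** The Dedekind cut of [x], transported to the integers by an enumeration of the
rationals. *)
Definition rational_cut (x : R) (k : nat) : bool :=
  if @unpickle rat k is Some q then ratr q < x else false.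

Lemma rational_cut_inj : injective rational_cut.
Proof.
have cut_lt x y : x < y -> rational_cut x <> rational_cut y.
  move=> /rat_in_itvoo[q]; rewrite in_itv /= => /andP[xq qy].
  move=> /(congr1 (fun h => h (pickle q))).
  by rewrite /rational_cut pickleK qy => /(lt_trans xq); rewrite ltxx.
move=> x y exy; case: (ltgtP x y) => // [/cut_lt|/cut_lt] //.
by rewrite exy.
Qed.

End TernaryReal.

Lemma card_le_of_inj {T U : Type} (A : set T) (B : set U) (g : T -> U) :
  (forall x, A x -> B (g x)) -> set_inj A g -> A #<= B.
Proof.
move=> gAB g_inj.
have /injfunPex/unsquash h : exists2 f : T -> U, set_fun A B f & set_inj A f.
  by exists g.
exact: inj_card_le h.
Qed.

(** The Cantor space of binary sequences serves as the intermediate between [A] and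
the real line in both directions of the Cantor-Bernstein theorem. *)
Lemma card_eq_continuum (R : realType) {T : Type} (A : set T)
    (encode : T -> nat -> bool) (decode : (nat -> bool) -> T) :
    injective encode -> injective decode -> (forall f, A (decode f)) ->
  A #= [set: R].
Proof.
move=> enc_inj dec_inj decA; rewrite card_eq_le; apply/andP; split.
  apply: (@card_le_of_inj _ _ _ _ (fun x => ternary_real R (encode x))) => //.
  by move=> x y _ _ /ternary_real_inj/enc_inj.
apply: (@card_le_of_inj _ _ _ _ (fun x => decode (@rational_cut R x))) => // x y _ _.
by move=> /dec_inj/rational_cut_inj.
Qed.

(** * Twisting a coloring level by level *)

(** The graph of [c], as a set of integers coding pairs: it bounds the number of all
maps to the colors by the continuum. *)
Definition coloring_code {n : nat} {X : set nat} (c : X -> 'I_n) (k : nat) : bool :=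
  if @unpickle (nat * 'I_n)%type k is Some (m, i)
  then `[< exists x : X, val x = m /\ c x = i >] else false.

Lemma coloring_code_inj {n : nat} {X : set nat} :
  injective (@coloring_code n X).
Proof.
move=> c d ecd; apply/funext => x.
have := congr1 (fun h => h (pickle (val x, c x))) ecd.
rewrite /coloring_code pickleK.
have -> : `[< exists y : X, val y = val x /\ c y = c x >] by apply/asboolP; exists x.
by move=> /esym/asboolP[y [/val_inj -> ->]].
Qed.

(** [f] lists the choices for the levels 2, 3, ...; the levels 0 and 1 are left alone
because they carry the points 1, ..., n whose colors are imposed. *)
Definition twist {n : nat} {X : set nat} (c : X -> 'I_n) (sigma : 'I_n -> 'I_n)
    (level : X -> nat) (f : nat -> bool) (x : X) : 'I_n :=
  if (1 < level x) && f (level x - 2) then sigma (c x) else c x.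

Section Twist.
Variables (n : nat) (X : set nat) (c : X -> 'I_n).
Variables (sigma : 'I_n -> 'I_n) (level : X -> nat).
Hypotheses (c_sat : @satisfactory n X c) (sigma_inj : injective sigma).
Hypothesis sigma_free : forall i, sigma i != i.
Hypothesis level_colors :
  forall (x : X) (i : 'I_n), val x = i.+1 -> level x <= 1.
Hypothesis level_surj : forall k, exists x, level x = k.+2.
Hypothesis level_sep : forall (a x y : X) (i j : 'I_n),
  val x = i.+1 * val a -> val y = j.+1 * val a -> level x != level y ->
  c x != sigma (c y).

(** Two multiples of the same point either lie on one level, where [sigma] acts on
both or on neither, or are protected by [level_sep], used in both orders. *)
Lemma twist_satisfactory f : @satisfactory n X (twist c sigma level f).
Proof.
case: (c_sat) => c_sep c_id; split=> [a x y i j xE yE ij|x i xE]; last first.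
  by rewrite /twist ltnNge (level_colors xE) /= (c_id _ _ xE).
rewrite /twist; have [eq_level|neq_level] := eqVneq (level x) (level y).
  rewrite eq_level; case: ifP => _; last exact: c_sep xE yE ij.
  by rewrite (inj_eq sigma_inj); exact: c_sep xE yE ij.
have xy := level_sep xE yE neq_level.
have yx : c y != sigma (c x) by apply: level_sep yE xE _; rewrite eq_sym.
case: ifP => _; case: ifP => _ //.
- by rewrite (inj_eq sigma_inj); exact: c_sep xE yE ij.
- by rewrite eq_sym.
- exact: c_sep xE yE ij.
Qed.

(** Since [sigma] moves every color, a single point on level [k + 2] reveals whether
that level was twisted. *)
Lemma twist_inj : injective (twist c sigma level).
Proof.
move=> f g efg; apply/funext => k; have [x xk] := level_surj k.
have := congr1 (fun h => h x) efg; rewrite /twist xk subn2 /=.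
case: (f k); case: (g k) => // /eqP; first by rewrite (negPf (sigma_free _)).
by rewrite eq_sym (negPf (sigma_free _)).
Qed.

Lemma twist_continuum (R : realType) : @satisfactory n X #= [set: R].
Proof.
exact: card_eq_continuum coloring_code_inj twist_inj twist_satisfactory.
Qed.

End Twist.

(** * Colorings of the positive integers *)

Lemma exists_mem {X : set nat} {m : nat} : X m -> exists x : X, val x = m.
Proof. by move=> Xm; exists (SigSub (mem_set Xm)). Qed.

Lemma logn_coprime_factor q n (i : 'I_n) m :
  prime q -> n < q -> 0 < m -> logn q (i.+1 * m) = logn q m.
Proof.
move=> q_pr nq m_gt0; rewrite lognM// [logn q i.+1]lognE q_pr /=.
by rewrite gtnNdvd// (leq_ltn_trans (ltn_ord i)).
Qed.

(** The valuation at a prime above [n] is constant on [a, 2a, ..., na], so these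
points are always shifted together. *)
Lemma posnat_continuum (R : realType) n : 1 < n ->
  @satisfactory n posnat !=set0 -> @satisfactory n posnat #= [set: R].
Proof.
move=> n_gt1 [c c_sat]; have [q nq q_pr] := prime_above n.
pose level (x : posnat) := logn q (val x).
have posnat_gt0 (x : posnat) : 0 < val x := set_valP x.
have level_mul (a x : posnat) (i : 'I_n) :
    val x = i.+1 * val a -> level x = level a.
  by move=> xE; rewrite /level xE logn_coprime_factor.
apply: (@twist_continuum n posnat c (@ordS n) level c_sat (@ordS_inj n)).
(* The cyclic shift has no fixed point: it adds 1, except that the last color,
     which is not the first one as [n > 1], is sent to the first. *)
- move=> i; rewrite -val_eqE /=; have := ltn_ord i.
  rewrite leq_eqVlt => /orP[/eqP iE|/modn_small ->]; last by rewrite gtn_eqF.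
  by rewrite iE modnn; apply: contraTneq n_gt1 => i0; rewrite -iE -i0.
- move=> x i xE; rewrite /level xE -[i.+1]muln1 logn_coprime_factor//.
  by rewrite logn1.
- move=> k; have [|x xE] := @exists_mem posnat (q ^ k.+2).
    by rewrite /posnat /= expn_gt0 prime_gt0.
  by exists x; rewrite /level xE pfactorK.
- move=> a x y i j xE yE.
  by rewrite (level_mul _ _ _ xE) (level_mul _ _ _ yE) eqxx.
Qed.

(** The two factors collect the prime factors above [n] and those at most [n]. *)
Lemma smooth_rough_factorization n m : 0 < m ->
  exists a k, [/\ rough n a, smooth n k & m = a * k].
Proof.
move=> m_gt0; pose pi := [pred p | p <= n] : nat_pred.
exists (m`_pi^'), (m`_pi); split; last by rewrite mulnC partnC.
- split=> [|p p_pr pm]; first exact: part_gt0.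
  by have := pnatPpi (part_pnat pi^' m) (p := p); rewrite mem_primes p_pr part_gt0 pm !inE -ltnNge; apply.
- split=> [|p p_pr pm]; first exact: part_gt0.
  by have := pnatPpi (part_pnat pi m) (p := p); rewrite mem_primes p_pr part_gt0 pm; apply.
Qed.

Lemma posnat_mul_rough_smooth {n} (a : rough n) (k : smooth n) :
  posnat (val a * val k).
Proof.
by rewrite /posnat /= muln_gt0 (proj1 (set_valP a)) (proj1 (set_valP k)).
Qed.

(** The permutation [pi a] records the colors of [a, 2a, ..., na], which are pairwise
distinct; undoing it on the multiples of [a] restores the normalization.
Uniqueness holds because every positive integer is a product of a rough and a
smooth one. *)
Lemma posnat_decomposition n (c : posnat -> 'I_n) : @satisfactory n posnat c ->
  exists (cs : rough n -> smooth n -> 'I_n) (pi : rough n -> {perm 'I_n}),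
    [/\ forall a : rough n, @satisfactory n (smooth n) (cs a),
        forall a : rough n, val a = 1 -> pi a = 1%g,
        glues c cs pi
      & forall c' : posnat -> 'I_n, glues c' cs pi -> c' = c].
Proof.
move=> [c_sep c_id].
pose mulc m (Pm : posnat m) : 'I_n := c (SigSub (mem_set Pm)).
have mulc_eq (x : posnat) m (Pm : posnat m) : val x = m -> c x = mulc m Pm.
  by move=> xE; congr c; apply: val_inj.
have rough_pos (a : rough n) : posnat (val a) := proj1 (set_valP a).
pose pi0 (a : rough n) (i : 'I_n) : 'I_n :=
  mulc _ (posnat_mul i (rough_pos a)).
have pi0_inj a : injective (pi0 a).
  move=> i j; apply: contra_eq => ij.
  exact: (c_sep (SigSub (mem_set (rough_pos a))) _ _ i j).
pose pi a := perm (@pi0_inj a).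
pose cs (a : rough n) (k : smooth n) :=
  ((pi a)^-1)%g (mulc _ (posnat_mul_rough_smooth a k)).
have c_glues : glues c cs pi.
  by move=> a k x xE; rewrite /cs permKV; exact: mulc_eq.
exists cs, pi; split=> //.
- move=> a; split=> [b x y i j xE yE ij|x i xE].
    rewrite /cs (inj_eq perm_inj).
    apply: (c_sep (SigSub (mem_set (posnat_mul_rough_smooth a b))) _ _ i j) ij => /=.
      by rewrite xE mulnCA.
    by rewrite yE mulnCA.
  rewrite /cs; apply: (canLR (permK _)); rewrite permE.
  by apply: mulc_eq => /=; rewrite xE mulnC.
- move=> a a1; apply/permP => i; rewrite perm1 permE.
  by apply: c_id => /=; rewrite a1 muln1.
- move=> c' c'_glues; apply/funext => x.
  have [m [k [/exists_mem[a <-] /exists_mem[b <-] xE]]] :=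
    smooth_rough_factorization n (set_valP x).
  by rewrite (c'_glues _ _ _ xE) (c_glues _ _ _ xE).
Qed.

(** * Colorings by residues modulo a prime *)

(** The residue of [x] modulo [n + 2] is nonzero when [n + 2] is prime; the predecessor
converts it to the index of a color, since colors are numbered from 0. *)
Definition residue_coloring {n : nat} (x : smooth n.+1) : 'I_n.+1 :=
  inord (val x %% n.+2).-1.

Section Residue.
Variable n : nat.
Hypothesis p_prime : prime n.+2.

Lemma smooth_ndvd (x : smooth n.+1) : ~~ (n.+2 %| val x).
Proof.
by apply/negP => /(proj2 (set_valP x) _ p_prime); rewrite ltnn.
Qed.

Lemma residue_coloringS (x : smooth n.+1) :
  (residue_coloring x).+1 = val x %% n.+2.
Proof.
have r_gt0 : 0 < val x %% n.+2.
  by have := smooth_ndvd x; rewrite /dvdn lt0n.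
by rewrite /residue_coloring inordK prednK// -ltnS ltn_mod.
Qed.

Lemma eq_mod_smooth_mul (a : smooth n.+1) (k l : nat) :
  (k * val a == l * val a %[mod n.+2]) = (k == l %[mod n.+2]).
Proof.
have a_cop : coprime n.+2 (val a) by rewrite prime_coprime// smooth_ndvd.
wlog kl : k l / k <= l => [wl|].
  by case/orP: (leq_total k l) => /wl //; rewrite eq_sym => ->; rewrite eq_sym.
by rewrite eq_sym [RHS]eq_sym !eqn_mod_dvd ?leq_mul// -mulnBl Gauss_dvdl.
Qed.

Lemma residue_coloring_satisfactory :
  @satisfactory n.+1 (smooth n.+1) residue_coloring.
Proof.
have lt_colors (i : 'I_n.+1) : i.+1 < n.+2 := ltn_ord i.
split=> [a x y i j xE yE ij|x i xE].
  rewrite -val_eqE -eqSS !residue_coloringS xE yE eq_mod_smooth_mul.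
  by rewrite !modn_small.
by apply/val_inj/succn_inj; rewrite residue_coloringS xE modn_small.
Qed.

End Residue.

(** * Cores with finitely many and with continuum many colorings *)

Lemma smooth2_pow (x : smooth 2) : val x = 2 ^ logn 2 (val x).
Proof.
have [x_gt0 x_smooth] := set_valP x.
rewrite -p_part part_pnat_id//; apply/pnatP => // p p_pr /(x_smooth _ p_pr).
by rewrite leq_eqVlt !inE ltnNge (prime_gt1 p_pr) orbF.
Qed.

(** The two colors must alternate along 1, 2, 4, 8, ..., starting from the imposed
color of 1. *)
Lemma satisfactory2_unique (c d : smooth 2 -> 'I_2) :
  @satisfactory 2 (smooth 2) c -> @satisfactory 2 (smooth 2) d -> c = d.
Proof.
move=> [c_sep c_id] [d_sep d_id]; apply/funext => x.
have := smooth2_pow x; move: (logn _ _) => k; elim: k x => [|k IH] x xE.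
  by rewrite (c_id x ord0 xE) (d_id x ord0 xE).
have [|a aE] := @exists_mem (smooth 2) (2 ^ k).
  split=> [|p p_pr]; first by rewrite expn_gt0.
  by rewrite Euclid_dvdX// => /andP[/dvdn_leq->].
have aE1 : val a = (ord0 : 'I_2).+1 * val a by rewrite mul1n.
have xEa : val x = (ord_max : 'I_2).+1 * val a by rewrite aE xE expnS.
have := c_sep a a x _ _ aE1 xEa isT; have := d_sep a a x _ _ aE1 xEa isT.
rewrite (IH _ aE).
by case: (c x) (d x) (d a) => [[|[]]] // ? [[|[]]] // ? [[|[]]] // ? _ _;
   apply: val_inj.
Qed.

Lemma smooth2_finite : finite_set (@satisfactory 2 (smooth 2)).
Proof.
have c_sat := @residue_coloring_satisfactory 1 isT.
apply: (@sub_finite_set _ _ [set residue_coloring]); last exact: finite_set1.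
by move=> d d_sat; exact: satisfactory2_unique.
Qed.

(** Multiplication by 2 modulo 7 on the nonzero residues, read on color indices. *)
Definition doubling7 (i : 'I_6) : 'I_6 := inord ((i.+1 * 2) %% 7).-1.

Lemma doubling7S i : (doubling7 i).+1 = (i.+1 * 2) %% 7.
Proof.
by rewrite /doubling7; case: i => [[|[|[|[|[|[|//]]]]]] ?]; rewrite inordK.
Qed.

Definition level35 (m : nat) : nat := logn 3 m + logn 5 m.

Lemma level35M k m : 0 < k -> 0 < m -> level35 (k * m) = level35 k + level35 m.
Proof. by move=> k_gt0 m_gt0; rewrite /level35 !lognM// addnACA. Qed.

(** The numbers 1, 2, 4 have level 0 and are the squares modulo 7; 3, 5, 6 have level
1 and are the nonsquares.  As 2 is a square, doubling cannot send one class to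
the other. *)
Lemma level35_separates (i j : 'I_6) :
  level35 i.+1 != level35 j.+1 -> i.+1 != j.+1 * 2 %[mod 7].
Proof.
by case: i j => [[|[|[|[|[|[|//]]]]]] ?] [[|[|[|[|[|[|//]]]]]] ?]; vm_compute.
Qed.

(** The residue coloring modulo 7 is twisted by doubling; an equality of colors
between multiples [i * a] and [j * a] passes to [i] and [j], as [a] is
invertible modulo 7. *)
Lemma smooth6_continuum (R : realType) :
  @satisfactory 6 (smooth 6) #= [set: R].
Proof.
have p7 : prime 7 by [].
have smooth_gt0 (a : smooth 6) : 0 < val a := proj1 (set_valP a).
apply: (@twist_continuum 6 (smooth 6) residue_coloring doubling7
  (fun x => level35 (val x)) (residue_coloring_satisfactory p7)).
- move=> i j /(congr1 (fun h : 'I_6 => h.+1)); rewrite !doubling7S => ij.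
  apply/val_inj/succn_inj; move: ij.
  by case: i j => [[|[|[|[|[|[|//]]]]]] ?] [[|[|[|[|[|[|//]]]]]] ?].
- move=> i; rewrite -val_eqE -eqSS doubling7S.
  by case: i => [[|[|[|[|[|[|//]]]]]] ?].
- by move=> x i ->; case: i => [[|[|[|[|[|[|//]]]]]] ?].
- move=> k; have [|x xE] := @exists_mem (smooth 6) (3 ^ k.+2).
    split=> [|p p_pr]; first by rewrite expn_gt0.
    by rewrite Euclid_dvdX// => /andP[/(dvdn_leq (isT : 0 < 3))/leq_trans->].
  by exists x; rewrite xE /level35 pfactorK// lognX muln0 addn0.
- move=> a x y i j xE yE; rewrite xE yE !level35M// eqn_add2r.
  move=> /level35_separates ij; rewrite -val_eqE -eqSS doubling7S.
  rewrite !residue_coloringS// modnMml xE yE mulnAC.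
  by rewrite (eq_mod_smooth_mul p7).
Qed.

Theorem theorem1p7 (R : realType) :
  (forall n : nat, 1 < n ->
     @satisfactory n posnat !=set0 ->
     @satisfactory n posnat #= [set: R])
  /\
  (forall n : nat, 0 < n ->
     forall c : posnat -> 'I_n, @satisfactory n posnat c ->
     exists (cs : rough n -> smooth n -> 'I_n) (pi : rough n -> {perm 'I_n}),
       [/\ forall a : rough n, @satisfactory n (smooth n) (cs a),
           forall a : rough n, val a = 1 -> pi a = 1%g,
           glues c cs pi
         & forall c' : posnat -> 'I_n, glues c' cs pi -> c' = c])
  /\
  ((exists n : nat,
      [/\ 1 < n, @satisfactory n (smooth n) !=set0
        & finite_set (@satisfactory n (smooth n))])
   /\
   (exists n : nat,
      1 < n /\ @satisfactory n (smooth n) #= [set: R])).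
Proof.
split; first exact: posnat_continuum.
split; first by move=> n _; exact: posnat_decomposition.
split; last by exists 6; split=> //; exact: smooth6_continuum.
exists 2; split=> //; last exact: smooth2_finite.
by exists residue_coloring; exact: residue_coloring_satisfactory.
Qed.
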